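(* For all $\alpha\in\mathcal C$, $$\widetilde\omega\big(\overleftarrow{\mathbf e}_\alpha\big)=\overleftarrow{\mathbf h}_{\widehat\alpha},\qquad \widetilde\omega\big(\overleftarrow{\mathbf h}_\alpha\big)=\overleftarrow{\mathbf e}_{\widehat\alpha}.$$
   Context: Ring. $\Lambda^-=\Lambda(\ldots,x_{-1},x_0)$ is the ring of symmetric functions over $\mathbb Q$ in the variables $x_i$, $i\le 0$, and $\mathcal R=\Lambda^-\otimes_{\mathbb Q}\mathbb Q[x_i\mid i\in\mathbb Z]$, identified via multiplication with a ring of bounded-degree formal power series in the variables $x_i$, $i\in\mathbb Z$. For every $k\in\mathbb Z$ and $d\ge 0$ the elementary and complete homogeneous symmetric functions $\mathbf e_d(\ldots,x_{k-1},x_k)$, $\mathbf h_d(\ldots,x_{k-1},x_k)$ in the variables $x_i$, $i\le k$, lie in $\mathcal R$. Back stable SEMs and CHMs. $\mathcal C$ is the set of finitely supported tuples $\alpha=(\alpha_i)_{i\in\mathbb Z}$ of nonnegative integers. For $\alpha\in\mathcal C$, $\overleftarrow{\mathbf e}_\alpha=\prod_{i\in\mathbb Z}\mathbf e_{\alpha_i}(\ldots,x_{i-1},x_i)$ and $\overleftarrow{\mathbf h}_\alpha=\prod_{i\in\mathbb Z}\mathbf h_{\alpha_i}(\ldots,x_{i-1},x_i)$. The reversal of $\alpha$ is $\widehat\alpha_i=\alpha_{-i}$. The involution. $\widetilde\omega:\mathcal R\to\mathcal R$ is the $\mathbb Q$-algebra involution (Lam–Lee–Shimozono) determined by $\widetilde\omega(e_r)=h_r$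 for $r\ge 1$, where $e_r=\mathbf e_r(\ldots,x_{-1},x_0)$ and $h_r=\mathbf h_r(\ldots,x_{-1},x_0)$ in $\Lambda^-$, and $\widetilde\omega(x_i)=-x_{1-i}$ for every $i\in\mathbb Z$ (on the polynomial tensor factor). *)

(* Defs.v *)
From HB Require Import structures.
From mathcomp Require Import all_boot all_order all_algebra.
From mathcomp Require Import finmap monalg boolp.

Set Implicit Arguments.
Unset Strict Implicit.
Unset Printing Implicit Defensive.

Import Order.TTheory GRing.Theory Num.Theory.

Local Open Scope fset_scope.
Local Open Scope ring_scope.

Local Notation "1" := (@mone _) : monom_scope.
Local Notation "x * y" := (mmul x y) : monom_scope.

(* A formal power series over Q in the variables x_i, i : int, is the function
   giving its coefficients on the monomials (finitely supported exponents). *)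
Definition series : Type := {cmonom int} -> rat.

HB.instance Definition _ := Choice.on series.

Section SeriesZmodule.
Implicit Types f g h : series.

Definition sadd f g : series := fun m => f m + g m.
Definition sopp f : series := fun m => - f m.
Definition szero : series := fun=> 0.
Definition sscale (c : rat) f : series := fun m => c * f m.

Fact saddA : associative sadd.
Proof. by move=> f g h; apply/funext=> m; rewrite /sadd addrA. Qed.

Fact saddC : commutative sadd.
Proof. by move=> f g; apply/funext=> m; rewrite /sadd addrC. Qed.

Fact sadd0 : left_id szero sadd.
Proof. by move=> f; apply/funext=> m; rewrite /sadd add0r. Qed.

Fact saddN : left_inverse szero sopp sadd.
Proof. by move=> f; apply/funext=> m; rewrite /sadd addNr. Qed.
End SeriesZmodule.

HB.instance Definition _ := GRing.isZmodule.Build series saddA saddC sadd0 saddN.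

Section SeriesLmodule.
Implicit Types f g h : series.

Fact sscaleA a b f : sscale a (sscale b f) = sscale (a * b) f.
Proof. by apply/funext=> m; rewrite /sscale mulrA. Qed.

Fact sscale1 : left_id 1 sscale.
Proof. by move=> f; apply/funext=> m; rewrite /sscale mul1r. Qed.

Fact sscaleDr : right_distributive sscale +%R.
Proof. by move=> a f g; apply/funext=> m; rewrite /sscale [LHS]mulrDr. Qed.

Fact sscaleDl f : {morph sscale^~ f : a b / a + b}.
Proof. by move=> a b; apply/funext=> m; rewrite /sscale [LHS]mulrDl. Qed.
End SeriesLmodule.

HB.instance Definition _ :=
  GRing.Zmodule_isLmodule.Build rat series sscaleA sscale1 sscaleDr sscaleDl.

Section Divisors.
Implicit Types m a b : {cmonom int}.

Definition mdivs m : {fset {cmonom int}} :=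
  [fset a in [seq [cmonom (g i : nat) | i : finsupp m]%M
             | g : {ffun finsupp m -> 'I_(mdeg m).+1}]
   | (a * divcm m a)%M == m].

Lemma leq_mdeg m i : (m i <= mdeg m)%N.
Proof.
by case: mdomP => // hi; rewrite mdegE (big_fsetD1 i) //= leq_addr.
Qed.

Lemma divcmK m a b : (a * b)%M = m -> divcm m a = b.
Proof.
by move=> <-; apply/eqP/cmP=> i; rewrite divcmE cmM addKn.
Qed.

Lemma in_mdivs m a : (a \in mdivs m) = ((a * divcm m a)%M == m).
Proof.
rewrite !inE /=; case: eqP => [e|_]; last by rewrite andbF.
rewrite andbT; apply/imageP.
have le i : (a i <= m i)%N by rewrite -e cmM leq_addr.
exists [ffun i : finsupp m => inord (a (val i))] => //.
apply/eqP/cmP=> i; rewrite cmE fsfun_ffun; case: insubP => /= [u _ uE|].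
  by rewrite ffunE inordK uE // ltnS (leq_trans (le i)) // leq_mdeg.
rewrite -cmE_eq0 => /eqP mi0; apply/eqP; rewrite -leqn0.
by apply: leq_trans (le i) _; rewrite mi0.
Qed.

Lemma mdivsP m a : reflect (exists b, (a * b)%M = m) (a \in mdivs m).
Proof.
rewrite in_mdivs; apply: (iffP eqP) => [e|[b e]]; first by exists (divcm m a).
by rewrite (divcmK e).
Qed.
End Divisors.

Section SeriesRing.
Implicit Types f g h : series.
Implicit Types m a b : {cmonom int}.

Definition smul f g : series :=
  fun m => \sum_(a <- mdivs m) f a * g (divcm m a).

Definition sone : series := fun m => (m == 1%M)%:R.

Lemma smulEw (D : {fset {cmonom int}}) f g m : mdivs m `<=` D ->
  smul f g m = \sum_(a <- D) \sum_(b <- D) (f a * g b) *+ ((a * b)%M == m).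
Proof.
move=> sD.
have inner a : a \in D ->
    \sum_(b <- D) (f a * g b) *+ ((a * b)%M == m) =
    if a \in mdivs m then f a * g (divcm m a) else 0.
  move=> aD; case: ifPn => [am|aN]; last first.
    rewrite big1_seq // => b _; case: eqP => // e.
    by case/negP: aN; apply/mdivsP; exists b.
  have e : (a * divcm m a)%M = m by apply/eqP; rewrite -in_mdivs.
  have bD : divcm m a \in D.
    apply: (fsubsetP sD); apply/mdivsP; exists a.
    by rewrite mulmC.
  rewrite (big_fsetD1 _ bD) /= e eqxx big1_seq ?addr0 // => b.
  rewrite !inE => /andP[_ /andP[bn _]]; case: eqP => // /divcmK eb.
  by rewrite eb eqxx in bn.
rewrite [RHS](eq_big_seq _ inner) /smul.
rewrite (eq_big_seq (fun a => if a \in mdivs m then f a * g (divcm m a) else 0)).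
  by apply: big_fset_incl => // a _ /negbTE->.
by move=> a ->.
Qed.

Lemma smulE f g m :
  smul f g m = \sum_(a <- mdivs m) \sum_(b <- mdivs m)
                 (f a * g b) *+ ((a * b)%M == m).
Proof. exact: smulEw. Qed.

Fact smulC : commutative smul.
Proof.
move=> f g; apply/funext=> m; rewrite !smulE exchange_big /=.
by apply: eq_bigr => a _; apply: eq_bigr => b _; rewrite mulrC mulmC.
Qed.

Lemma mdivs_sub m a : a \in mdivs m -> mdivs a `<=` mdivs m.
Proof.
move=> /mdivsP[b <-]; apply/fsubsetP=> c /mdivsP[d <-].
by apply/mdivsP; exists (d * b)%M; rewrite mulmA.
Qed.

Lemma sum_mdivs1 m c (r : rat) (P : pred {cmonom int}) :
  (P c -> c \in mdivs m) ->
  \sum_(a <- mdivs m) r *+ (c == a) *+ P a = r *+ P c.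
Proof.
move=> cm; case: (boolP (c \in mdivs m)) => [cD|cN].
  rewrite (big_fsetD1 _ cD) /= eqxx mulr1n big1_seq ?addr0 // => b.
  by rewrite in_fsetD1 => /andP[_ /andP[/negbTE bc _]]; rewrite eq_sym bc mul0rn.
rewrite (contraNF cm cN) big1_seq // => a /andP[_ am].
by case: eqP cN => [->|_ _]; rewrite ?am // mul0rn.
Qed.

Lemma smul3l f g h m :
  smul (smul f g) h m =
  \sum_(a <- mdivs m) \sum_(b <- mdivs m) \sum_(c <- mdivs m)
    (f a * g b * h c) *+ ((a * b * c)%M == m).
Proof.
rewrite smulE.
under eq_big_seq => x xm.
  under eq_bigr => c _.
    rewrite (smulEw _ _ (mdivs_sub xm)) mulr_suml.
    under eq_bigr => a _ do rewrite mulr_suml.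
    rewrite -!sumrMnl.
    under eq_bigr => a _ do rewrite -sumrMnl.
    over.
  over.
rewrite exchange_big /=.
under eq_bigr => c _.
  rewrite exchange_big /=.
  under eq_bigr => a _.
    rewrite exchange_big /=.
    under eq_bigr => b _.
      under eq_bigr => x _ do rewrite mulrnAl.
      rewrite (sum_mdivs1 _ (P := fun x => (x * c)%M == m)); last first.
        by move=> /eqP e; apply/mdivsP; exists c.
      over.
    over.
  over.
rewrite exchange_big /=; apply: eq_bigr => a _.
by rewrite exchange_big.
Qed.

Lemma sum_mdivsC (D : {fset {cmonom int}})
    (F : {cmonom int} -> {cmonom int} -> {cmonom int} -> rat) :
  \sum_(a <- D) \sum_(b <- D) \sum_(c <- D) F a b c =
  \sum_(b <- D) \sum_(c <- D) \sum_(a <- D) F a b c.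
Proof.
rewrite exchange_big /=; apply: eq_bigr => b _.
by rewrite exchange_big.
Qed.

Fact smulA : associative smul.
Proof.
move=> f g h; apply/funext=> m; rewrite smulC !smul3l 2!sum_mdivsC.
apply: eq_bigr => c _; apply: eq_bigr => a _; apply: eq_bigr => b _.
by rewrite -(mulrC (f c)) mulrA -(mulmC c) mulmA.
Qed.

Fact smul1 : left_id sone smul.
Proof.
move=> f; apply/funext=> m; rewrite /smul.
have m1 : 1%M \in mdivs m by apply/mdivsP; exists m; rewrite mul1m.
rewrite (big_fsetD1 _ m1) /= /sone eqxx mul1r big1_seq ?addr0.
  by congr f; apply: divcmK; rewrite mul1m.
by move=> a; rewrite in_fsetD1 => /andP[_ /andP[/negbTE-> _]]; rewrite mul0r.
Qed.

Fact smulDl : left_distributive smul +%R.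
Proof.
move=> f g h; apply/funext=> m; rewrite /smul [RHS]/GRing.add /= /sadd.
by rewrite -big_split; apply: eq_bigr => a _; rewrite [X in X * _]/GRing.add /= /sadd mulrDl.
Qed.

Fact sone_neq0 : sone != 0.
Proof.
by apply/eqP => /(congr1 (@^~ 1%M)); rewrite /sone eqxx => /eqP; rewrite oner_eq0.
Qed.

End SeriesRing.

HB.instance Definition _ := GRing.Zmodule_isComNzRing.Build series
  smulA smulC smul1 smulDl sone_neq0.

Lemma scoefD (f g : series) m : (f + g) m = f m + g m. Proof. by []. Qed.
Lemma scoefN (f : series) m : (- f) m = - f m. Proof. by []. Qed.
Lemma scoefZ c (f : series) m : (c *: f) m = c * f m. Proof. by []. Qed.
Lemma scoef0 m : (0 : series) m = 0. Proof. by []. Qed.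
Lemma scoef1 m : (1 : series) m = (m == 1%M)%:R. Proof. by []. Qed.
Lemma scoefM (f g : series) m :
  (f * g) m = \sum_(a <- mdivs m) f a * g (divcm m a).
Proof. by []. Qed.

Fact sscaleAl (c : rat) (f g : series) : c *: (f * g) = (c *: f) * g.
Proof.
apply/funext=> m; rewrite scoefZ !scoefM mulr_sumr.
by apply: eq_bigr => a _; rewrite scoefZ mulrA.
Qed.

HB.instance Definition _ := GRing.Lmodule_isLalgebra.Build rat series sscaleAl.
HB.instance Definition _ := GRing.Lalgebra_isComAlgebra.Build rat series.

Lemma scoefM_neq0 (f g : series) m : (f * g) m != 0 ->
  exists a b, [/\ (a * b)%M = m, f a != 0 & g b != 0].
Proof.
move=> nz; suff [a am fg] : exists2 a, a \in mdivs m & f a * g (divcm m a) != 0.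
  exists a, (divcm m a); move: fg; rewrite mulf_eq0 negb_or => /andP[-> ->].
  by split=> //; apply/eqP; rewrite -in_mdivs.
apply/not_exists2P => none; case/eqP: nz; rewrite scoefM big1_seq // => a /andP[_ am].
by have [|/negP] := none a; rewrite ?negbK // => /eqP.
Qed.

Definition bounded_degree (f : series) : Prop :=
  exists N : nat, forall m, f m != 0 -> (mdeg m <= N)%N.

Definition in_vars_le (k : int) (f : series) : Prop :=
  forall m, f m != 0 -> forall i, i \in finsupp m -> i <= k.

(* Invariance under the permutations s of the index set {i | i <= 0}, extended
   by the identity to all of int. *)
Definition symmetric_le0 (f : series) : Prop :=
  forall (s : int -> int) (m m' : {cmonom int}),
    bijective s -> (forall i, 0 < i -> s i = i) ->
    (forall i, m' i = m (s i)) -> f m' = f m.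

(* Symmetric functions in the variables x_i, i <= 0. *)
Definition LambdaNeg (f : series) : Prop :=
  [/\ bounded_degree f, in_vars_le 0 f & symmetric_le0 f].

Definition is_polynomial (f : series) : Prop :=
  exists S : {fset {cmonom int}}, forall m, f m != 0 -> m \in S.

(* The image of the multiplication map from the tensor product of LambdaNeg and
   Q[x_i | i : int] to series. *)
Definition backsym_pred : pred series := fun f =>
  `[< exists2 s : seq (series * series),
        (forall u, u \in s -> LambdaNeg u.1 /\ is_polynomial u.2) &
        f = \sum_(u <- s) u.1 * u.2 >].

Lemma bounded_degreeM f g :
  bounded_degree f -> bounded_degree g -> bounded_degree (f * g).
Proof.
move=> [N fN] [P gP]; exists (N + P)%N => m /scoefM_neq0[a [b [<- /fN fa /gP gb]]].
by rewrite mdegM leq_add.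
Qed.

Lemma in_vars_leM k f g : in_vars_le k f -> in_vars_le k g -> in_vars_le k (f * g).
Proof.
move=> fk gk m /scoefM_neq0[a [b [<- /fk fa /gk gb]]] i.
by rewrite mdomD in_fsetU => /orP[/fa|/gb].
Qed.

Lemma symmetric_le0M f g :
  symmetric_le0 f -> symmetric_le0 g -> symmetric_le0 (f * g).
Proof.
move=> fs gs s m m' [t sK tK] s0 m'E.
pose pm (r r' : int -> int) (a : {cmonom int}) : {cmonom int} :=
  [cmonom a (r i) | i in [fset r' j | j in finsupp a]]%M.
have pmE r r' a : cancel r r' -> forall i, pm r r' a i = a (r i).
  move=> rK i; rewrite /pm cmE fsfun_fun; case: ifP => // /negbT iN.
  apply/esym/eqP; rewrite cmE_eq0; apply: contra iN => ai.
  by apply/imfsetP; exists (r i) => //=; rewrite rK.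
pose p := pm s t; pose q := pm t s.
have pE a i : p a i = a (s i) by apply: pmE.
have qE a i : q a i = a (t i) by apply: pmE.
have pq a : p (q a) = a by apply/eqP/cmP => i; rewrite pE qE sK.
have qp a : q (p a) = a by apply/eqP/cmP => i; rewrite qE pE tK.
have pM a b : p (a * b)%M = (p a * p b)%M.
  by apply/eqP/cmP => i; rewrite pE !cmM !pE.
have -> : m' = p m by apply/eqP/cmP => i; rewrite m'E pE.
have fp a : f (p a) = f a by apply: (fs s) => //; exists t.
have gp a : g (p a) = g a by apply: (gs s) => //; exists t.
have sub : mdivs (p m) `<=` [fset p a | a in mdivs m].
  apply/fsubsetP => a /mdivsP[b e]; apply/imfsetP; exists (q a); rewrite ?pq //=.
  apply/mdivsP; exists (q b); apply: (can_inj qp).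
  by rewrite pM !pq.
have pI : {in mdivs m &, injective p} by move=> a b _ _; apply: (can_inj qp).
rewrite -[LHS]/(smul f g (p m)) (smulEw _ _ sub).
rewrite big_imfset //= -[RHS]/(smul f g m) smulE.
apply: eq_bigr => a _; rewrite big_imfset //=; apply: eq_bigr => b _.
by rewrite fp gp -pM (inj_eq (can_inj qp)).
Qed.

Lemma LambdaNegM f g : LambdaNeg f -> LambdaNeg g -> LambdaNeg (f * g).
Proof.
move=> [f1 f2 f3] [g1 g2 g3]; split.
- exact: bounded_degreeM.
- exact: in_vars_leM.
- exact: symmetric_le0M.
Qed.

Lemma LambdaNegZ c f : LambdaNeg f -> LambdaNeg (c *: f).
Proof.
have nz m : (c *: f) m != 0 -> f m != 0.
  by rewrite scoefZ mulf_eq0 negb_or => /andP[].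
move=> [[N f1] f2 f3]; split.
- by exists N => m /nz /f1.
- by move=> m /nz /f2.
- by move=> s m m' bs s0 e; rewrite !scoefZ (f3 s m m').
Qed.

Lemma LambdaNeg1 : LambdaNeg 1.
Proof.
have nz m : (1 : series) m != 0 -> m = 1%M.
  by rewrite scoef1; case: (m =P 1%M) => // _ /eqP.
split.
- by exists 0%N => m /nz ->; rewrite mdeg1.
- by move=> m /nz -> i; rewrite mdom1.
- move=> s m m' [t sK tK] s0 e; rewrite !scoef1; congr (nat_of_bool _)%:R.
  apply/cmP/cmP => h i; rewrite ?e cm1.
    by rewrite -(tK i) -e h cm1.
  by rewrite h cm1.
Qed.

Lemma is_polynomialM f g :
  is_polynomial f -> is_polynomial g -> is_polynomial (f * g).
Proof.
move=> [S fS] [T gT]; exists [fset (a * b)%M | a in S, b in T].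
move=> m /scoefM_neq0[a [b [<- /fS fa /gT gb]]].
by apply/imfset2P; exists a => //=; exists b.
Qed.

Lemma is_polynomial1 : is_polynomial 1.
Proof.
by exists [fset 1%M] => m; rewrite scoef1 in_fset1; case: (m =P 1%M) => // _ /eqP.
Qed.

Fact backsym_closed : subalg_closed backsym_pred.
Proof.
split.
- apply/asboolP; exists [:: (1, 1)]; last by rewrite big_seq1 mulr1.
  by move=> u; rewrite inE => /eqP->; split; [exact: LambdaNeg1|exact: is_polynomial1].
- move=> c f g /asboolP[s sP ->] /asboolP[t tP ->]; apply/asboolP.
  exists ([seq (c *: u.1, u.2) | u <- s] ++ t).
    move=> u; rewrite mem_cat => /orP[/mapP[v /sP[v1 v2] ->]|/tP//].
    by split=> //; apply: LambdaNegZ.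
  rewrite big_cat big_map scaler_sumr; congr (_ + _).
  by apply: eq_bigr => u _; rewrite scalerAl.
- move=> f g /asboolP[s sP ->] /asboolP[t tP ->]; apply/asboolP.
  exists [seq (u.1 * v.1, u.2 * v.2) | u <- s, v <- t].
    move=> w /allpairsP[[u v] /= [/sP[u1 u2] /tP[v1 v2] ->]] /=.
    by split; [apply: LambdaNegM|apply: is_polynomialM].
  rewrite big_allpairs_dep big_distrl; apply: eq_bigr => u _.
  rewrite big_distrr; apply: eq_bigr => v _ /=.
  by rewrite mulrACA.
Qed.

HB.instance Definition _ :=
  GRing.isSubalgClosed.Build rat series backsym_pred backsym_closed.

(* The ring R = LambdaNeg (x) Q[x_i | i : int] of back symmetric functions. *)
Record backsym := Backsym { backsym_val :> series; _ : backsym_val \in backsym_pred }.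

HB.instance Definition _ := [isSub for backsym_val].
HB.instance Definition _ := [Choice of backsym by <:].
HB.instance Definition _ := [SubChoice_isSubAlgebra of backsym by <:].
HB.instance Definition _ := [SubNzRing_isSubComNzRing of backsym by <:].

Definition xser (i : int) : series := fun m => (m == ucm i)%:R.

(* e_d(..., x_{k-1}, x_k) and h_d(..., x_{k-1}, x_k). *)
Definition eser (k : int) (d : nat) : series := fun m =>
  ((mdeg m == d) && all (fun i => (i <= k) && (m i <= 1)%N) (finsupp m))%:R.
Definition hser (k : int) (d : nat) : series := fun m =>
  ((mdeg m == d) && all (fun i => i <= k) (finsupp m))%:R.

Lemma eser_supp k (m : {cmonom int}) :
  reflect (forall i, (m i <= (i <= k)%R)%N)
    (all (fun i => (i <= k) && (m i <= 1)%N) (finsupp m)).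
Proof.
apply: (iffP allP) => [h i|h i].
  by case: (mdomP m i) => // /h /andP[-> ->].
rewrite -cmE_neq0 -lt0n => mi; have := h i.
by case: (i <= k) => /= hi; rewrite ?hi // in mi *; case: (m i) mi hi.
Qed.

Lemma hser_supp k (m : {cmonom int}) :
  reflect (forall i, k < i -> m i = 0%N) (all (fun i => i <= k) (finsupp m)).
Proof.
apply: (iffP allP) => [h i ki|h i].
  by case: (mdomP m i) => // /h; rewrite leNgt ki.
by rewrite -cmE_neq0 leNgt; apply: contraNN => /h ->.
Qed.

Lemma eser0 k : eser k 0 = 1.
Proof.
apply/funext => m; rewrite scoef1 /eser mdeg_eq0.
case: (m =P 1%M) => // ->; rewrite (introT allP) // => i.
by rewrite mdom1.
Qed.

Lemma hser0 k : hser k 0 = 1.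
Proof.
apply/funext => m; rewrite scoef1 /hser mdeg_eq0.
case: (m =P 1%M) => // ->; rewrite (introT allP) // => i.
by rewrite mdom1.
Qed.

Lemma xserM_out i (f : series) (m : {cmonom int}) : m i = 0%N -> (xser i * f) m = 0.
Proof.
move=> mi; rewrite scoefM big1_seq // => a /andP[_ /mdivsP[b e]].
rewrite /xser; case: (a =P ucm i) => [ai|]; last by rewrite mul0r.
by move/eqP: mi; rewrite -e ai cmM cmUU.
Qed.

Lemma xserM i (f : series) (m : {cmonom int}) : (xser i * f) (ucm i * m)%M = f m.
Proof.
have ui : ucm i \in mdivs (ucm i * m)%M by apply/mdivsP; exists m.
rewrite scoefM (big_fsetD1 _ ui) /= /xser eqxx mul1r (divcmK (b := m)) //.
rewrite big1_seq ?addr0 // => a; rewrite in_fsetD1 => /andP[_ /andP[/negbTE-> _]].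
by rewrite mul0r.
Qed.

Lemma ucm_split i (m : {cmonom int}) : m i != 0%N -> exists m', m = (ucm i * m')%M.
Proof.
move=> mi; exists (divcm m (ucm i)); apply/eqP/cmP => j.
rewrite cmM divcmE cmU; case: (i =P j) => [<-|_]; last by rewrite subn0.
by rewrite subnKC // lt0n.
Qed.

Lemma lezB1 (i k : int) : (i <= k - 1) = (i < k).
Proof. by rewrite lerBrDr lezD1. Qed.

Lemma eserS k d : eser k d.+1 = eser (k - 1) d.+1 + xser k * eser (k - 1) d.
Proof.
apply/funext => m; rewrite scoefD.
have [mk|/ucm_split[{}m ->]] := eqVneq (m k) 0%N.
  rewrite xserM_out // addr0; congr (nat_of_bool (_ && _))%:R.
  apply/eser_supp/eser_supp => h i; have := h i; rewrite lezB1 le_eqVlt;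
    by case: (i =P k) => //= ->; rewrite mk.
rewrite xserM [X in X + _](_ : _ = 0) ?add0r; last first.
  rewrite /eser; case: eser_supp => [|_]; last by rewrite andbF.
  by move=> /(_ k); rewrite lezB1 ltxx cmM cmUU.
congr (nat_of_bool (_ && _))%:R; first by rewrite mdegM mdegU.
apply/eser_supp/eser_supp => h i; have := h i; rewrite cmM cmU lezB1 le_eqVlt;
  rewrite eq_sym; by case: (i =P k) => //= ->; rewrite ltxx.
Qed.

Lemma hserS k d : hser k d.+1 = hser (k - 1) d.+1 + xser k * hser k d.
Proof.
apply/funext => m; rewrite scoefD.
have [mk|/ucm_split[{}m ->]] := eqVneq (m k) 0%N.
  rewrite xserM_out // addr0; congr (nat_of_bool (_ && _))%:R.
  apply/hser_supp/hser_supp => h i; last by move=> ki; apply: h; rewrite ltrBlDr ltzD1 ltW.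
  by rewrite ltrBlDr ltzD1 le_eqVlt => /orP[/eqP<-//|]; apply: h.
rewrite xserM [X in X + _](_ : _ = 0) ?add0r; last first.
  rewrite /hser; case: hser_supp => [|_]; last by rewrite andbF.
  by move=> /(_ k); rewrite ltrBlDr ltzD1 lexx cmM cmUU => /(_ isT).
congr (nat_of_bool (_ && _))%:R; first by rewrite mdegM mdegU.
apply/hser_supp/hser_supp => h i ki; have := h i ki; rewrite cmM cmU lt_eqF //.
Qed.

Lemma mdeg_perm (s : int -> int) (m m' : {cmonom int}) :
  bijective s -> (forall i, m' i = m (s i)) -> mdeg m' = mdeg m.
Proof.
move=> [t sK tK] e; have sub : finsupp m' `<=` [fset t i | i in finsupp m].
  apply/fsubsetP => i; rewrite -cmE_neq0 e cmE_neq0 => hi.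
  by apply/imfsetP; exists (s i); rewrite ?sK.
rewrite (mdegEw sub) mdegE big_imfset /=; last by move=> i j _ _; apply: (can_inj tK).
by apply: eq_bigr => i _; rewrite e tK.
Qed.

Lemma perm_le0 (s : int -> int) : bijective s -> (forall i, 0 < i -> s i = i) ->
  forall i, (s i <= 0) = (i <= 0).
Proof.
move=> bs s0 i; have [i0|i0] := leP i 0; last by rewrite s0 // leNgt i0.
by rewrite leNgt; apply/negP => si; have := bij_inj bs (s0 _ si) => e; rewrite e ltNge i0 in si.
Qed.

Lemma eser_LambdaNeg d : LambdaNeg (eser 0 d).
Proof.
have nz m : eser 0 d m != 0 -> mdeg m = d /\ forall i, (m i <= (i <= 0)%R)%N.
  by rewrite /eser; case: (mdeg m =P d) => //= <-; case: eser_supp.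
split.
- by exists d => m /nz[->].
- move=> m /nz[_ h] i; rewrite -cmE_neq0; have := h i.
  by case: (i <= 0) => //; case: (m i).
- move=> s m m' bs s0 e; rewrite /eser (mdeg_perm bs e); congr (nat_of_bool (_ && _))%:R.
  apply/eser_supp/eser_supp => h i; last by rewrite e -(perm_le0 bs s0).
  by have [t sK tK] := bs; rewrite -(tK i) -e (perm_le0 bs s0).
Qed.

Lemma hser_LambdaNeg d : LambdaNeg (hser 0 d).
Proof.
have nz m : hser 0 d m != 0 -> mdeg m = d /\ all (fun i => i <= 0) (finsupp m).
  by rewrite /hser; case: (mdeg m =P d) => //= <-; case: all.
split.
- by exists d => m /nz[->].
- by move=> m /nz[_ /allP].
- move=> s m m' bs s0 e; rewrite /hser (mdeg_perm bs e); congr (nat_of_bool (_ && _))%:R.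
  apply/hser_supp/hser_supp => h i i0; last first.
    by rewrite e h // ltNge (perm_le0 bs s0) -ltNge.
  by rewrite -(s0 _ i0) -e h.
Qed.

Lemma LambdaNeg_backsym f : LambdaNeg f -> f \in backsym_pred.
Proof.
move=> hf; apply/asboolP; exists [:: (f, 1)]; last by rewrite big_seq1 mulr1.
by move=> u; rewrite inE => /eqP->; split=> //; apply: is_polynomial1.
Qed.

Fact xser_backsym i : xser i \in backsym_pred.
Proof.
apply/asboolP; exists [:: (1, xser i)]; last by rewrite big_seq1 mul1r.
move=> u; rewrite inE => /eqP->; split; first exact: LambdaNeg1.
exists [fset ucm i] => m; rewrite in_fset1 /= /xser.
by case: (m =P ucm i) => // _ /eqP.
Qed.

Fact eser_backsym k d : eser k d \in backsym_pred.
Proof.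
elim/int_rect: k d => [d|n IH [|d]|n IH].
- exact/LambdaNeg_backsym/eser_LambdaNeg.
- by rewrite eser0 rpred1.
- by rewrite eserS -predn_int //= rpredD ?rpredM ?xser_backsym.
have e d : eser (- n.+1%:Z) d.+1 =
    eser (- n%:Z) d.+1 - xser (- n%:Z) * eser (- n.+1%:Z) d.
  have -> : - n.+1%:Z = - n%:Z - 1 by rewrite intS opprD addrC.
  by rewrite (eserS (- n%:Z)) addrK.
elim=> [|d IHd]; first by rewrite eser0 rpred1.
by rewrite e rpredB ?rpredM ?xser_backsym.
Qed.

Fact hser_backsym k d : hser k d \in backsym_pred.
Proof.
elim/int_rect: k d => [d|n IH|n IH [|d]].
- exact/LambdaNeg_backsym/hser_LambdaNeg.
- elim=> [|d IHd]; first by rewrite hser0 rpred1.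
  by rewrite hserS -predn_int //= rpredD ?rpredM ?xser_backsym.
- by rewrite hser0 rpred1.
have -> : hser (- n.+1%:Z) d.+1 =
    hser (- n%:Z) d.+1 - xser (- n%:Z) * hser (- n%:Z) d.
  have -> : - n.+1%:Z = - n%:Z - 1 by rewrite intS opprD addrC.
  by rewrite (hserS (- n%:Z)) addrK.
by rewrite rpredB ?rpredM ?xser_backsym.
Qed.

Definition bsx (i : int) : backsym := Backsym (xser_backsym i).
Definition bse (k : int) (d : nat) : backsym := Backsym (eser_backsym k d).
Definition bsh (k : int) (d : nat) : backsym := Backsym (hser_backsym k d).

Definition zcomp := {fsfun int -> nat with 0%N}.

(* The factors with i outside finsupp alpha are e_0 = h_0 = 1. *)
Definition back_e (alpha : zcomp) : backsym :=
  \prod_(i <- finsupp alpha) bse i (alpha i).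
Definition back_h (alpha : zcomp) : backsym :=
  \prod_(i <- finsupp alpha) bsh i (alpha i).

Definition reversal (alpha : zcomp) : zcomp :=
  [fsfun i in [fset - j | j in finsupp alpha] => alpha (- i)].

Lemma reversalE alpha i : reversal alpha i = alpha (- i).
Proof.
rewrite fsfun_fun; case: ifPn => // iN; apply/esym/eqP; rewrite -memNfinsupp.
by apply: contra iN => ai; apply/imfsetP; exists (- i); rewrite ?opprK.
Qed.

(* The properties that determine the Lam-Lee-Shimozono involution. *)
Record is_omega_tilde (w : {lrmorphism backsym -> backsym}) : Prop := {
  omega_tildeK : involutive w;
  omega_tilde_e : forall r : nat, (1 <= r)%N -> w (bse 0 r) = bsh 0 r;
  omega_tilde_x : forall i : int, w (bsx i) = - bsx (1 - i)
}.

(* Main.v *)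
(** The involution sends e_d(..., x_k) to h_d(..., x_(-k)) for every k.  This
holds by hypothesis at k = 0 and propagates to all k, since the involution
exchanges the two one-variable recursions
  e_(d+1)(..., x_k) = e_(d+1)(..., x_(k-1)) + x_k e_d(..., x_(k-1)),
  h_(d+1)(..., x_(1-k)) = h_(d+1)(..., x_(-k)) + x_(1-k) h_d(..., x_(1-k)). *)
Require Import Defs.
From mathcomp Require Import all_boot all_order all_algebra.
From mathcomp Require Import finmap monalg boolp.

Import GRing.Theory.
Local Open Scope fset_scope.
Local Open Scope ring_scope.

Lemma bse0 k : bse k 0 = 1.
Proof. exact/val_inj/eser0. Qed.

Lemma bsh0 k : bsh k 0 = 1.
Proof. exact/val_inj/hser0. Qed.

Lemma bseS k d : bse k d.+1 = bse (k - 1) d.+1 + bsx k * bse (k - 1) d.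
Proof. exact/val_inj/eserS. Qed.

Lemma bshS k d : bsh k d.+1 = bsh (k - 1) d.+1 + bsx k * bsh k d.
Proof. exact/val_inj/hserS. Qed.

(** Recursion [bseS] involves only index [k - 1] on its right side, so no induction on [d] is
    needed: the image of [bsx k] is [- bsx (1 - k)], which cancels the product term of [bshS] at
    [1 - k]. *)
Lemma omega_tilde_bse_succ (w : {lrmorphism backsym -> backsym}) k :
  is_omega_tilde w -> (forall d, w (bse (k - 1) d) = bsh (1 - k) d) ->
  forall d, w (bse k d) = bsh (- k) d.
Proof.
move=> hw IH [|d]; first by rewrite bse0 rmorph1 bsh0.
rewrite bseS rmorphD rmorphM /= !IH (omega_tilde_x hw) mulNr bshS addrK.
by congr (bsh _ _); rewrite addrAC subrr add0r.
Qed.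

(** Solving [bseS] for [bse (k - 1) d.+1] leaves [bse (k - 1) d] on the right, hence the induction
    on [d]. *)
Lemma omega_tilde_bse_pred (w : {lrmorphism backsym -> backsym}) k :
  is_omega_tilde w -> (forall d, w (bse k d) = bsh (- k) d) ->
  forall d, w (bse (k - 1) d) = bsh (1 - k) d.
Proof.
move=> hw IH; elim=> [|d IHd]; first by rewrite bse0 rmorph1 bsh0.
have -> : bse (k - 1) d.+1 = bse k d.+1 - bsx k * bse (k - 1) d.
  by rewrite (bseS k) addrK.
rewrite rmorphB rmorphM /= IH IHd (omega_tilde_x hw) mulNr opprK.
by rewrite [RHS]bshS [1 - k - 1]addrAC subrr add0r.
Qed.

Lemma omega_tilde_bse (w : {lrmorphism backsym -> backsym}) k d :
  is_omega_tilde w -> w (bse k d) = bsh (- k) d.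
Proof.
move=> hw; elim/int_rect: k d => [d|n IH|n IH].
(* The hypothesis on [w] starts at degree 1; in degree 0 both sides are 1. *)
- rewrite oppr0; case: d => [|d]; first by rewrite bse0 rmorph1 bsh0.
  exact: omega_tilde_e.
- apply: omega_tilde_bse_succ => // d.
  by rewrite -predn_int //= IH intS opprD addNKr.
- move=> d; have -> : - n.+1%:Z = - n%:Z - 1 by rewrite intS opprD addrC.
  by rewrite opprB; apply: omega_tilde_bse_pred.
Qed.

Lemma finsupp_reversal alpha :
  finsupp (reversal alpha) = [fset - j | j in finsupp alpha].
Proof.
apply/fsetP=> i; rewrite mem_finsupp reversalE -mem_finsupp.
apply/idP/imfsetP => [ai|[j /= aj ->]]; last by rewrite opprK.
by exists (- i); rewrite ?opprK.
Qed.

Lemma reversalK : involutive reversal.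
Proof. by move=> alpha; apply/fsfunP=> i; rewrite !reversalE opprK. Qed.

Lemma omega_tilde_back_e (w : {lrmorphism backsym -> backsym}) alpha :
  is_omega_tilde w -> w (back_e alpha) = back_h (reversal alpha).
Proof.
move=> hw; rewrite /back_e /back_h rmorph_prod finsupp_reversal.
(* Reindex the product over the reversed support by the injection [j] to [- j]. *)
rewrite big_imfset /=; last by move=> i j _ _; apply: oppr_inj.
by apply: eq_bigr => i _; rewrite omega_tilde_bse // reversalE opprK.
Qed.

Theorem theorem4p4 (w : {lrmorphism backsym -> backsym})
    (hw : is_omega_tilde w) (alpha : zcomp) :
  w (back_e alpha) = back_h (reversal alpha) /\
  w (back_h alpha) = back_e (reversal alpha).
Proof.
split; first exact: omega_tilde_back_e.
(* After applying the injective [w] to both sides, the claim is the first identity at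
   [reversal alpha]. *)
apply: (inv_inj (omega_tildeK hw)).
by rewrite (omega_tildeK hw) omega_tilde_back_e // reversalK.
Qed.
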